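(* Let $Q=(0,1)^2$, $(u_\eta,u_c)\in BV(Q)\times BV(Q)$, and let $\mathscr L$ be a finite partition of $Q$ into dyadic squares. Let $\omega_{\mathscr L}=\sum_{L\in\mathscr L}\alpha_L\chi_L:Q\to[0,\infty)$ with $\alpha_L$ the optimal local parameters given in the context. For $\varepsilon>0$ let $\omega^\varepsilon_{\mathscr L}:Q\to[0,\infty)$ satisfy $\omega^\varepsilon_{\mathscr L}\in C^1(Q)$ and $\omega^\varepsilon_{\mathscr L}\nearrow\omega_{\mathscr L}$ a.e. in $Q$ as $\varepsilon\to0^+$. Define $E_{\mathscr L},E^\varepsilon_{\mathscr L}:L^1(Q)\to[0,\infty]$ by $$E_{\mathscr L}[u]=\begin{cases}\int_Q|u_\eta-u|^2dx+TV_{\omega_{\mathscr L}}(u,Q)&\text{if }u\in BV_{\omega_{\mathscr L}}(Q),\\+\infty&\text{otherwise,}\end{cases}\qquad E^\varepsilon_{\mathscr L}[u]=\begin{cases}\int_Q|u_\eta-u|^2dx+TV_{\omega^\varepsilon_{\mathscr L}}(u,Q)&\text{if }u\in BV_{\omega^\varepsilon_{\mathscr L}}(Q),\\+\infty&\text{otherwise.}\end{cases}$$ Then $\Gamma(L^1(Q))\text{-}\limsup_{\varepsilon\to0^+}E^\varepsilon_{\mathscr L}\le E_{\mathscr L}$, i.e. for every $u\in L^1(Q)$ $$\inf\Big\{\limsup_{\varepsilon\to0^+}E^\varepsilon_{\mathscr L}[u_\varepsilon]:\ u_\varepsilon\to u\ \text{strongly in }L^1(Q)\Big\}\le E_{\mathscr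 L}[u].$$
   Context: A dyadic square of $Q=(0,1)^2$ is a set $L=(z+(0,2^{-k}]^2)\cap Q$ with $k\in\mathbb N_0$ and $z\in 2^{-k}\mathbb Z^2\cap[0,1)^2$. Spaces and variations on $L$ are understood on the interior of $L$; $TV(u,L)=|Du|(L)$. For a locally integrable $\omega:Q\to[0,\infty)$, $TV_\omega(u,Q)=\sup\{\int_Q u\,\mathrm{div}\,\varphi\,dx:\ \varphi\in\mathrm{Lip}_c(Q;\mathbb R^2),\ |\varphi|\le\omega\}$ ($\mathrm{Lip}_c$: compactly supported Lipschitz maps), and $BV_\omega(Q)=\{u \text{ measurable}:\int_Q|u|\,\omega\,dx<\infty,\ TV_\omega(u,Q)<\infty\}$. Optimal local parameters: for a dyadic square $L$ and $\alpha\in(0,\infty)$, $u_{\alpha,L}$ is the unique minimizer over $u\in BV(L)$ of $\int_L|u_\eta-u|^2\,dx+\alpha\,TV(u,L)$, and $\alpha_L\in[0,\infty]$ is the smallest minimizer of the continuous extension of $\alpha\mapsto\int_L|u_c-u_{\alpha,L}|^2dx$ to $[0,\infty]$; it is assumed here that $\alpha_L<\infty$ for all $L\in\mathscr L$, so that $\omega_{\mathscr L}$ is a nonnegative real-valued weight. *)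

(* Defs.v *)
From HB Require Import structures.
From mathcomp Require Import all_boot all_order all_algebra.
From mathcomp Require Import all_classical all_reals all_analysis.

Set Implicit Arguments.
Unset Strict Implicit.
Unset Printing Implicit Defensive.

Import Order.TTheory GRing.Theory Num.Theory.
Import numFieldNormedType.Exports.

Local Open Scope classical_set_scope.
Local Open Scope ring_scope.

(* Elements of L^1 and BV are represented by Borel functions on the plane, of
   which only the values on the open set W in question matter. *)

Notation leb2 R := (@lebesgue_measure R \x @lebesgue_measure R)%E.

Definition unit_square (R : realType) : set (R * R) :=
  `]0, 1[%classic `*` `]0, 1[%classic.
Arguments unit_square R : clear implicits.

Definition enorm (R : realType) (v : R * R) : R :=
  Num.sqrt (v.1 ^+ 2 + v.2 ^+ 2).

(* For a Lipschitz field the partial derivatives exist almost everywhere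
   (Rademacher); the values elsewhere are irrelevant under the integral. *)
Definition div (R : realType) (phi : R * R -> R * R) (x : R * R) : R :=
  'D_(1, 0) (fun y => (phi y).1) x + 'D_(0, 1) (fun y => (phi y).2) x.

Definition compactly_supported (R : realType) (W : set (R * R))
    (phi : R * R -> R * R) : Prop :=
  exists K : set (R * R),
    [/\ compact K, K `<=` W & forall x, W x -> ~ K x -> phi x = 0].

Definition C1 (R : realType) (V : normedModType R) (W : set (R * R))
    (f : R * R -> V) : Prop :=
  forall x, W x -> differentiable f x /\
    forall v, {for x, continuous (fun y => 'D_v f y)}.

Definition C1c (R : realType) (W : set (R * R)) : set (R * R -> R * R) :=
  [set phi | C1 W phi /\ compactly_supported W phi].

Definition Lipc (R : realType) (W : set (R * R)) : set (R * R -> R * R) :=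
  [set phi | [lipschitz phi x | x in W] /\ compactly_supported W phi].

Definition L1 (R : realType) (W : set (R * R)) (u : R * R -> R) : Prop :=
  (leb2 R).-integrable W (EFin \o u).

(* |Du|(W), as the variation of u in the open set W *)
Definition TV (R : realType) (W : set (R * R)) (u : R * R -> R) : \bar R :=
  ereal_sup [set (\int[leb2 R]_(x in W) (u x * div phi x)%:E)%E | phi in
    C1c W `&` [set phi | forall x, W x -> enorm (phi x) <= 1]].

Definition BV (R : realType) (W : set (R * R)) (u : R * R -> R) : Prop :=
  L1 W u /\ (TV W u < +oo)%E.

Definition TVw (R : realType) (omega : R * R -> R) (W : set (R * R))
    (u : R * R -> R) : \bar R :=
  ereal_sup [set (\int[leb2 R]_(x in W) (u x * div phi x)%:E)%E | phi in
    Lipc W `&` [set phi | forall x, W x -> enorm (phi x) <= omega x]].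

Definition BVw (R : realType) (omega : R * R -> R) (W : set (R * R))
    (u : R * R -> R) : Prop :=
  [/\ @measurable_fun _ _ (measurableTypeR R * measurableTypeR R)%type R W u,
      (\int[leb2 R]_(x in W) (`|u x| * omega x)%:E < +oo)%E
    & (TVw omega W u < +oo)%E].

Definition sqdist (R : realType) (W : set (R * R)) (u v : R * R -> R) :
    \bar R :=
  (\int[leb2 R]_(x in W) ((u x - v x) ^+ 2)%:E)%E.

Definition dyadic_square (R : realType) (L : set (R * R)) : Prop :=
  exists (k : nat) (i j : int) (z : R * R),
    [/\ z = (i%:~R / 2 ^+ k, j%:~R / 2 ^+ k),
        0 <= z.1 < 1, 0 <= z.2 < 1
      & L = (`]z.1, z.1 + 2 ^- k]%classic `*` `]z.2, z.2 + 2 ^- k]%classic)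
              `&` unit_square R].

Definition dyadic_partition (R : realType) (LL : set (set (R * R))) : Prop :=
  [/\ finite_set LL, forall L, LL L -> dyadic_square L
    & partition LL id (unit_square R)].

Definition ROF_energy (R : realType) (ueta : R * R -> R) (W : set (R * R))
    (a : R) (u : R * R -> R) : \bar R :=
  (sqdist W ueta u + a%:E * TV W u)%E.

(* By strict convexity, a minimizer is unique up to a null set. *)
Definition ROF_minimizer (R : realType) (ueta : R * R -> R)
    (W : set (R * R)) (a : R) (u : R * R -> R) : Prop :=
  BV W u /\
  forall v, BV W v -> (ROF_energy ueta W a u <= ROF_energy ueta W a v)%E.

(* J is the continuous extension to [0, +oo] of the map
   a |-> int_W |uc - u_{a,W}|^2 on ]0, +oo[; it is determined there by
   continuity, and its values at negative arguments are not used. *)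
Definition extended_cost (R : realType) (ueta uc : R * R -> R)
    (W : set (R * R)) (J : \bar R -> \bar R) : Prop :=
  {within [set a | (0 <= a)%E], continuous J} /\
  forall a : R, 0 < a ->
    exists2 u, ROF_minimizer ueta W a u & J a%:E = sqdist W uc u.

Definition optimal_parameter (R : realType) (ueta uc : R * R -> R)
    (L : set (R * R)) (a : \bar R) : Prop :=
  exists2 J, extended_cost ueta uc (interior L) J &
    [/\ (0 <= a)%E, forall b, (0 <= b)%E -> (J a <= J b)%E
      & forall b, (0 <= b)%E ->
          (forall c, (0 <= c)%E -> (J b <= J c)%E) -> (a <= b)%E].

Definition piecewise_weight (R : realType) (LL : set (set (R * R)))
    (alpha : set (R * R) -> R) (x : R * R) : R :=
  \sum_(L \in LL) alpha L * \1_L x.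

Definition monotone_to (R : realType) (W : set (R * R))
    (omega_eps : R -> R * R -> R) (omega : R * R -> R) : Prop :=
  {ae leb2 R, forall x, W x ->
    (forall e1 e2, 0 < e1 -> e1 <= e2 -> omega_eps e2 x <= omega_eps e1 x) /\
    omega_eps e x @[e --> 0^'+] --> omega x}.

Definition energy (R : realType) (ueta omega : R * R -> R) (W : set (R * R))
    (u : R * R -> R) : \bar R :=
  if `[< BVw omega W u >] then (sqdist W ueta u + TVw omega W u)%E else +oo%E.

Definition cvg_L1 (R : realType) (W : set (R * R)) (ue : R -> R * R -> R)
    (u : R * R -> R) : Prop :=
  (forall e, 0 < e -> L1 W (ue e)) /\
  (\int[leb2 R]_(x in W) `|ue e x - u x|%:E)%E @[e --> 0^'+] --> 0%E.

Definition Gamma_limsup (R : realType) (W : set (R * R))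
    (E : R -> (R * R -> R) -> \bar R) (u : R * R -> R) : \bar R :=
  ereal_inf [set limf_esup (fun e => E e (ue e)) 0^'+ |
    ue in [set ue | cvg_L1 W ue u]].

(* Main.v *)
Require Import Defs.
From mathcomp Require Import all_boot all_order all_algebra.
From mathcomp Require Import all_classical all_reals all_analysis.
From mathcomp Require Import lra.
Import Order.TTheory GRing.Theory Num.Theory.
Import numFieldNormedType.Exports.
Local Open Scope classical_set_scope.
Local Open Scope ring_scope.

(** The constant recovery sequence u works, because the weights satisfy
   omega_eps <= omega everywhere in Q, not only almost everywhere: every point x
   of a dyadic square L is a limit of points of the interior of L at which
   omega_eps <= alpha_L = omega x, and omega_eps is continuous at x.  Hence
   every field admissible for omega_eps is admissible for omega. *)

(** Otherwise the whole open rectangle would lie in a null set, although its area, the product of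
    the two side lengths, is positive. *)
Lemma rectangle_meets_conull (R : realType) (p q : R * R) (P : R * R -> Prop) :
  p.1 < q.1 -> p.2 < q.2 -> {ae leb2 R, forall x, P x} ->
  exists x, [/\ p.1 < x.1 < q.1, p.2 < x.2 < q.2 & P x].
Proof.
move=> h1 h2 [N [mN N0 PN]].
apply/not_existsP => h.
have sub : `]p.1, q.1[%classic `*` `]p.2, q.2[%classic `<=` N.
  move=> x [/=]; rewrite !in_itv/= => x1 x2; apply: PN => /= Px.
  by apply: (h x); split.
have mA : measurable (`]p.1, q.1[%classic `*` `]p.2, q.2[%classic :
  set (measurableTypeR R * measurableTypeR R)) by exact: measurableX.
have : (leb2 R (`]p.1, q.1[%classic `*` `]p.2, q.2[%classic) <= leb2 R N)%E.
  by apply: le_measure; rewrite ?inE.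
rewrite N0 [X in (X <= _)%E]product_measure1E//.
have len a b : a < b -> lebesgue_measure (`]a, b[%classic : set R) = (b - a)%:E.
  by move=> ab; rewrite lebesgue_measure_itv/= lte_fin ab EFinB.
rewrite [X in (X * _)%E](len _ _ h1) [X in (_ * X)%E](len _ _ h2).
by rewrite -EFinM lee_fin leNgt mulr_gt0// subr_gt0.
Qed.

(** No measurability is assumed: the integral of a nonnegative function is a supremum over the
    simple functions below it, and those below [f] are also below [g]. *)
Lemma le_integral_ge0 d (T : measurableType d) (R : realType)
    (mu : {measure set T -> \bar R}) (D : set T) (f g : T -> \bar R) :
  (forall x, D x -> 0 <= f x)%E -> (forall x, D x -> f x <= g x)%E ->
  (\int[mu]_(x in D) f x <= \int[mu]_(x in D) g x)%E.
Proof.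
move=> f0 fg; rewrite !ge0_integralE//; last first.
  by move=> x Dx; exact: le_trans (f0 x Dx) (fg x Dx).
apply: ereal_sup_le => _ [h hf <-]; exists h => // x.
by apply: le_trans (hf x) _; exact: lee_restrict.
Qed.

Section energy_le.
Context {R : realType} {W : set (R * R)} {omega1 omega2 : R * R -> R}.
Hypothesis omega1_ge0 : forall x, W x -> 0 <= omega1 x.
Hypothesis omega12 : forall x, W x -> omega1 x <= omega2 x.

Lemma le_TVw u : (TVw omega1 W u <= TVw omega2 W u)%E.
Proof.
apply: ereal_sup_le => _ [phi [Lphi phi1] <-]; exists phi => //.
by split=> // x Wx; exact: le_trans (phi1 x Wx) (omega12 x Wx).
Qed.

Lemma le_energy ueta u : (energy ueta omega1 W u <= energy ueta omega2 W u)%E.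
Proof.
(* Outside [BVw omega2] the right-hand side is [+oo]; inside it, [u] also belongs to [BVw omega1],
   so both energies are given by the sum. *)
rewrite /energy; case: (asboolP (BVw omega2 W u)) => [[mu iu tu]|_]; last first.
  exact: leey.
rewrite asboolT; first by rewrite leeD2l// le_TVw.
split=> //; last exact: le_lt_trans (le_TVw u) tu.
apply: le_lt_trans iu; apply: le_integral_ge0 => x Wx.
  by rewrite lee_fin mulr_ge0// omega1_ge0.
by rewrite lee_fin ler_wpM2l// omega12.
Qed.

End energy_le.

(** Where the values increase as the parameter decreases to 0, their limit dominates each of
    them. *)
Lemma monotone_to_ae_le (R : realType) (W : set (R * R))
    (omega_eps : R -> R * R -> R) (omega : R * R -> R) (e : R) :
  monotone_to W omega_eps omega -> 0 < e ->
  {ae leb2 R, forall x, W x -> omega_eps e x <= omega x}.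
Proof.
move=> hmono e0; move: hmono; apply: negligibleS => x /=.
apply: contra_not => + Wx => /(_ Wx)[mono lim].
apply: (cvgr_to_ge lim); near=> r; apply: mono => //.
by near: r; exact: nbhs_right_le.
Unshelve. all: by end_near.
Qed.

(** Dyadic squares are open on the left and below, so the lower left corner of [L] serves as [p],
    even when [x] lies on the upper or right edge. *)
Lemma dyadic_square_lower_left (R : realType) (L : set (R * R)) (x : R * R) :
  dyadic_square L -> L x ->
  exists p : R * R, [/\ p.1 < x.1, p.2 < x.2 &
    forall y, p.1 < y.1 < x.1 -> p.2 < y.2 < x.2 -> L y].
Proof.
move=> [k [i [j [z [_ /andP[z10 _] /andP[z20 _] ->]]]]].
move=> [[/=]]; rewrite !in_itv/= => /andP[a1 b1] /andP[a2 b2].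
move=> [/=]; rewrite !in_itv/= => /andP[_ c1] /andP[_ c2].
exists z; split=> // y /andP[d1 e1] /andP[d2 e2].
split; split; rewrite /= in_itv/=; apply/andP; split=> //.
- exact: le_trans (ltW e1) b1.
- exact: le_trans (ltW e2) b2.
- exact: le_lt_trans d1.
- exact: lt_trans c1.
- exact: le_lt_trans d2.
- exact: lt_trans c2.
Qed.

(** By disjointness, a member containing [x] or [y] is [L] itself, so the indicators agree term by
    term. *)
Lemma piecewise_weight_const (R : realType) (LL : set (set (R * R)))
    (alpha : set (R * R) -> R) (L : set (R * R)) (x y : R * R) :
  trivIset LL id -> LL L -> L x -> L y ->
  piecewise_weight LL alpha x = piecewise_weight LL alpha y.
Proof.
move=> tLL LLL Lx Ly; apply: eq_fsbigr => M /set_mem LLM; congr (_ * _).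
rewrite !indicE; suff -> : (x \in M) = (y \in M) by [].
apply/idP/idP => /set_mem Mz; apply/mem_set.
- by rewrite -(tLL L M LLL LLM); [|exists x].
- by rewrite -(tLL L M LLL LLM); [|exists y].
Qed.

(** The passage from almost every point to every point serves the pointwise constraint on the fields
    in [TVw]. *)
Lemma le_piecewise_weight (R : realType) (LL : set (set (R * R)))
    (alpha : set (R * R) -> R) (w : R * R -> R) (x : R * R) :
  dyadic_partition LL -> unit_square R x -> {for x, continuous w} ->
  {ae leb2 R, forall y, unit_square R y -> w y <= piecewise_weight LL alpha y} ->
  w x <= piecewise_weight LL alpha x.
Proof.
move=> [_ dyad [cov tLL _]] Qx cw hae; rewrite leNgt; apply/negP => gtx.
have [L LLL Lx] : cover LL id x by rewrite cov.
have : \forall y \near x, piecewise_weight LL alpha x < w y.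
  exact: cvgr_gt cw _ gtx.
move=> /nbhs_ballP[d /= d0 hd].
have [p [p1 p2 hp]] := dyadic_square_lower_left _ _ _ (dyad L LLL) Lx.
(* The open rectangle from [q] to [x] lies in [L] and in the ball of radius [d] around [x], which is
   a square since balls of the plane are products of intervals. *)
pose q := (Num.max p.1 (x.1 - d), Num.max p.2 (x.2 - d)).
have [||y [/= /andP[] + y1 /andP[] + y2 Py]] :=
  @rectangle_meets_conull R q x _ _ _ hae.
- by rewrite /= gt_max p1 ltrBlDr ltrDl.
- by rewrite /= gt_max p2 ltrBlDr ltrDl.
rewrite !gt_max => /andP[py1 dy1] /andP[py2 dy2].
have Ly : L y by apply: hp; apply/andP.
have Qy : unit_square R y by rewrite -cov; exists L.
have := Py Qy; rewrite (piecewise_weight_const _ _ alpha _ _ _ tLL LLL Ly Lx) leNgt.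
rewrite hd//; split => /=; rewrite /ball/= ltr_norml; apply/andP; split; lra.
Qed.

Theorem proposition1p6 (R : realType) (ueta uc : R * R -> R)
    (LL : set (set (R * R))) (alpha : set (R * R) -> R)
    (omega_eps : R -> R * R -> R)
    (hueta : BV (unit_square R) ueta) (huc : BV (unit_square R) uc)
    (hLL : dyadic_partition LL)
    (halpha : forall L, LL L -> optimal_parameter ueta uc L (alpha L)%:E)
    (hnneg : forall e x, 0 < e -> unit_square R x -> 0 <= omega_eps e x)
    (hC1 : forall e, 0 < e -> C1 (unit_square R) (omega_eps e))
    (hmono : monotone_to (unit_square R) omega_eps
               (piecewise_weight LL alpha))
    (u : R * R -> R) (hu : L1 (unit_square R) u) :
  (Gamma_limsup (unit_square R)
     (fun e => energy ueta (omega_eps e) (unit_square R)) u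
   <= energy ueta (piecewise_weight LL alpha) (unit_square R) u)%E.
Proof.
apply: ge_ereal_inf.
exists (limf_esup (fun e => energy ueta (omega_eps e) (unit_square R) u) 0^'+).
  exists (fun=> u) => //; split=> //=.
  under eq_integral do rewrite subrr normr0.
  by rewrite integral0; exact: cvg_cst.
(* The upper limit is an infimum of suprema over neighbourhoods; the one of all [e > 0] suffices, as
   the bound holds for each such [e]. *)
apply: ge_ereal_inf; eexists.
  by exists [set e | 0 < e]; [exact: nbhs_right_gt|reflexivity].
apply: ge_ereal_sup => _ [e /= e0 <-].
apply: le_energy => x Qx; first exact: hnneg.
apply: le_piecewise_weight => //.
  by apply: differentiable_continuous; case: (hC1 e e0 x Qx).
exact: monotone_to_ae_le.
Qed.
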